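(* Let $k\ge2$, let $\Gamma_k$ be the fundamental group of a closed oriented surface of genus $k$, let $\mathbb{C}\Gamma_k$ be its group $*$-algebra and $\varepsilon\colon\mathbb{C}\Gamma_k\to\mathbb{C}$ the linear extension of the trivial representation. Then $(\mathbb{C}\Gamma_k,\varepsilon)$ does not have property (LK); that is, there exists a generating functional on $(\mathbb{C}\Gamma_k,\varepsilon)$ that does not admit a Lévy-Khinchin decomposition.
   Context: $\Gamma_k=\langle a_1,\ldots,a_k,b_1,\ldots,b_k\mid a_1b_1a_1^{-1}b_1^{-1}\cdots a_kb_ka_k^{-1}b_k^{-1}\rangle$; the group $*$-algebra has involution $g^*=g^{-1}$, and $\varepsilon(g)=1$ for all group elements $g$. In the following $A=\mathbb{C}\Gamma_k$. A pre-Hilbert space is a complex vector space $D$ with a positive definite inner product, linear in the second argument; $L(D)$ is the $*$-algebra of adjointable linear operators $D\to D$. A generating functional on $(A,\varepsilon)$ is a linear $\psi\colon A\to\mathbb{C}$ with $\psi(1)=0$, $\psi(a^* )=\overline{\psi(a)}$ for all $a\in A$, and $\psi(a^*a)\ge0$ for all $a\in\ker\varepsilon$. A Schürmann triple $(\pi,\eta,\psi)$ over $D$ consists of a unital $*$-representation $\pi\colon A\to L(D)$, a $\pi$-$\varepsilon$-cocycle $\eta\colon A\to D$ (linear, $\eta(ab)=\pi(a)\eta(b)+\eta(a)\varepsilon(b)$), and a hermitian linear functional $\psi$ with $\varepsilon(a)\psi(b)-\psi(ab)+\psi(a)\varepsilon(b)=-\langle\eta(a^* ),\eta(b)\rangle$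 for all $a,b\in A$. Every generating functional $\psi$ is part of a Schürmann triple $(\pi,\eta,\psi)$ with $\eta$ surjective (GNS-type construction). Given such a triple with $\eta$ surjective, let $H$ be the completion of $D$, $H_R=\overline{\operatorname{span}}\{(\pi(a)-\varepsilon(a))v: a\in A, v\in D\}$, $H_G=H_R^\perp$, $P_G,P_R$ the orthogonal projections onto $H_G,H_R$, $D_G=P_GD$, $D_R=P_RD$, $\eta_G=P_G\circ\eta$, $\eta_R=P_R\circ\eta$. These are cocycles for the representations $\pi_G$ on $D_G$ and $\pi_R$ on $D_R$ given by $\pi_G(a)P_G\eta(b)=\varepsilon(a)P_G\eta(b)$ and $\pi_R(a)P_R\eta(b)=(\pi(a)-\varepsilon(a))\eta(b)+\varepsilon(a)P_R\eta(b)$. $\psi$ admits a Lévy-Khinchin decomposition if there are generating functionals $\psi_G,\psi_R$ with $\psi=\psi_G+\psi_R$ such that $(\pi_G,\eta_G,\psi_G)$ and $(\pi_R,\eta_R,\psi_R)$ are Schürmann triples. $(A,\varepsilon)$ has (LK) if every generating functional on $(A,\varepsilon)$ admits a Lévy-Khinchin decomposition. *)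

(* Defs.v *)
From HB Require Import structures.
From mathcomp Require Import all_boot all_order all_algebra finmap.
From mathcomp Require Import complex.
From mathcomp Require Import boolp classical_sets functions reals.
From mathcomp Require Import topology normedtype.
(* The notations of monalg are incompatible with those of mathcomp-analysis. *)
From mathcomp Require Import -(notations) monalg.

Set Implicit Arguments.
Unset Strict Implicit.
Unset Printing Implicit Defensive.

Import Order.TTheory GRing.Theory Num.Theory.
Import numFieldNormedType.Exports.

Local Open Scope ring_scope.
Local Open Scope classical_set_scope.

(* Group presentations. A word is a list of signed generators, (x, true)      *)
(* standing for x and (x, false) for x^-1.                                    *)

Section Presentation.
Local Open Scope quotient_scope.
Variables (X : choiceType) (rels : set (seq (X * bool))).
Implicit Types u v w : seq (X * bool).

Inductive pres_eq : seq (X * bool) -> seq (X * bool) -> Prop :=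
| pres_refl w : pres_eq w w
| pres_sym u v : pres_eq u v -> pres_eq v u
| pres_trans u v w : pres_eq u v -> pres_eq v w -> pres_eq u w
| pres_cat u u' v v' : pres_eq u u' -> pres_eq v v' -> pres_eq (u ++ v) (u' ++ v')
| pres_cancel x b : pres_eq [:: (x, b); (x, ~~ b)] [::]
| pres_rel r : rels r -> pres_eq r [::].

Definition winv w : seq (X * bool) := rev [seq (l.1, ~~ l.2) | l <- w].

Definition pres_eqb u v : bool := `[< pres_eq u v >].

Lemma pres_eqb_refl : reflexive pres_eqb.
Proof. by move=> w; apply/asboolP/pres_refl. Qed.

Lemma pres_eqb_sym : symmetric pres_eqb.
Proof. by move=> u v; apply/asboolP/asboolP => /pres_sym. Qed.

Lemma pres_eqb_trans : transitive pres_eqb.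
Proof.
by move=> v u w /asboolP uv /asboolP vw; apply/asboolP/(pres_trans uv vw).
Qed.

Canonical pres_equiv := EquivRel pres_eqb pres_eqb_refl pres_eqb_sym pres_eqb_trans.

Definition presented := {eq_quot pres_equiv}.
HB.instance Definition _ := Choice.on presented.
HB.instance Definition _ := Quotient.on presented.

Definition pres_class w : presented := \pi_presented w.

Lemma pres_classP u v : pres_class u = pres_class v <-> pres_eq u v.
Proof.
split=> [/eqmodP/asboolP //|uv]; exact/eqmodP/asboolP.
Qed.

Lemma pres_surj g : exists w, g = pres_class w.
Proof. by exists (repr g); rewrite /pres_class reprK. Qed.

Definition pres_mul (g h : presented) := pres_class (repr g ++ repr h).
Definition pres_inv (g : presented) := pres_class (winv (repr g)).

Lemma pres_reprK w : pres_eq (repr (pres_class w)) w.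
Proof. by apply/pres_classP; rewrite /pres_class reprK. Qed.

Lemma pres_mulE u v : pres_mul (pres_class u) (pres_class v) = pres_class (u ++ v).
Proof. by apply/pres_classP/pres_cat; exact: pres_reprK. Qed.

Lemma winv_cat u v : winv (u ++ v) = winv v ++ winv u.
Proof. by rewrite /winv map_cat rev_cat. Qed.

Lemma winvK : involutive winv.
Proof.
move=> w; rewrite /winv map_rev revK -map_comp -[RHS]map_id.
by apply: eq_map => -[x b] /=; rewrite negbK.
Qed.

Lemma pres_catV w : pres_eq (w ++ winv w) [::].
Proof.
elim: w => [|[x b] w IH]; first exact: pres_refl.
rewrite -cat1s winv_cat -catA (catA w).
apply: (pres_trans _ (pres_cancel x b)).
apply: (pres_cat (u' := [:: (x, b)]) (v' := [:: (x, ~~ b)])).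
  exact: pres_refl.
rewrite -[X in pres_eq _ X]cat0s.
by apply: pres_cat => //; exact: pres_refl.
Qed.

Lemma pres_winv u v : pres_eq u v -> pres_eq (winv u) (winv v).
Proof.
move=> uv.
have h1 : pres_eq (winv u ++ (v ++ winv v)) (winv u).
  rewrite -[X in pres_eq _ X]cats0.
  by apply: pres_cat; [exact: pres_refl | exact: pres_catV].
apply: (pres_trans (pres_sym h1)); rewrite catA -[X in pres_eq _ X]cat0s.
apply: pres_cat; last exact: pres_refl.
have h2 : pres_eq (winv u ++ v) (winv u ++ winv (winv u)).
  by rewrite winvK; apply: pres_cat; [exact: pres_refl | exact: pres_sym].
exact: (pres_trans h2 (pres_catV _)).
Qed.

Lemma pres_mulA : associative pres_mul.
Proof.
move=> g h j; have [u ->] := pres_surj g; have [v ->] := pres_surj h.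
by have [w ->] := pres_surj j; rewrite !pres_mulE catA.
Qed.

Lemma pres_mul1 : left_id (pres_class [::]) pres_mul.
Proof. by move=> g; have [u ->] := pres_surj g; rewrite pres_mulE. Qed.

Lemma pres_mulr1 : right_id (pres_class [::]) pres_mul.
Proof. by move=> g; have [u ->] := pres_surj g; rewrite pres_mulE cats0. Qed.

Lemma pres_invE u : pres_inv (pres_class u) = pres_class (winv u).
Proof. by apply/pres_classP/pres_winv; exact: pres_reprK. Qed.

Lemma pres_mulrV : right_inverse (pres_class [::]) pres_inv pres_mul.
Proof.
move=> g; have [u ->] := pres_surj g; rewrite pres_invE pres_mulE.
by apply/pres_classP; exact: pres_catV.
Qed.

Lemma pres_mulV : left_inverse (pres_class [::]) pres_inv pres_mul.
Proof.
move=> g; have [u ->] := pres_surj g; rewrite pres_invE pres_mulE.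
by apply/pres_classP; rewrite -{2}[u]winvK; exact: pres_catV.
Qed.

HB.instance Definition _ := isGroup.Build presented
  pres_mulA pres_mul1 pres_mulr1 pres_mulV pres_mulrV.

End Presentation.

(* The generators of the surface group of genus k are a_i = inl i and         *)
(* b_i = inr i, for i : 'I_k.                                                 *)
Definition surface_relator (k : nat) : seq (('I_k + 'I_k) * bool) :=
  flatten [seq [:: (inl i, true); (inr i, true); (inl i, false); (inr i, false)]
          | i <- enum 'I_k].

Definition surface_group (k : nat) := presented [set surface_relator k].
HB.instance Definition _ k := Group.on (surface_group k).

HB.mixin Record isStarAlgebra (C : numClosedFieldType) A of GRing.Algebra C A := {
  star : A -> A;
  starD : {morph star : a b / a + b};
  starZ : forall (c : C) a, star (c *: a) = c^* *: star a;
  starM : forall a b, star (a * b) = star b * star a;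
  starK : involutive star
}.

#[short(type="starAlgType")]
HB.structure Definition StarAlgebra (C : numClosedFieldType) :=
  {A of GRing.Algebra C A & isStarAlgebra C A}.

(* Finitely supported functions G -> K with convolution. The ring structure   *)
(* that monalg puts on malg requires a monoid without nontrivial units.       *)
Definition group_algebra (K : nzRingType) (G : groupType) := malg G K.

Section GroupAlgebra.
Variables (K : comNzRingType) (G : groupType).
Local Notation A := (group_algebra K G).
Implicit Types (a b : A) (x y : G).

HB.instance Definition _ := GRing.Lmodule.on A.

Definition gelt x : A := mkmalgU x 1.

Definition gmul a b : A :=
  \sum_(x <- msupp a) \sum_(y <- msupp b)
    mkmalgU (x * y)%g (mcoeff x a * mcoeff y b).

Lemma gmulw (d1 d2 : {fset G}) a b : (msupp a `<=` d1)%fset -> (msupp b `<=` d2)%fset ->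
  gmul a b = \sum_(x <- d1) \sum_(y <- d2)
               mkmalgU (x * y)%g (mcoeff x a * mcoeff y b).
Proof.
move=> le1 le2; rewrite /gmul (big_fset_incl _ le1) /=.
  apply: eq_bigr => x _; apply: big_fset_incl => // y _ /mcoeff_outdom ->.
  by rewrite mulr0 monalgU0.
by move=> x _ /mcoeff_outdom ax; rewrite big1 // => y _; rewrite ax mul0r monalgU0.
Qed.

Lemma gmulUU x y (c d : K) :
  gmul (mkmalgU x c) (mkmalgU y d) = mkmalgU (x * y)%g (c * d).
Proof. by rewrite (gmulw msuppU_le msuppU_le) !big_seq_fset1 !mcoeffUU. Qed.

Lemma gmulDl : left_distributive gmul +%R.
Proof.
move=> a1 a2 b.
rewrite (gmulw (msuppD_le a1 a2) (fsubset_refl _)).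
rewrite (gmulw (fsubsetUl (msupp a1) (msupp a2)) (fsubset_refl (msupp b))).
rewrite (gmulw (fsubsetUr (msupp a1) (msupp a2)) (fsubset_refl (msupp b))).
rewrite -big_split /=; apply: eq_bigr => x _.
rewrite -big_split /=; apply: eq_bigr => y _.
by rewrite mcoeffD mulrDl monalgUD.
Qed.

Lemma gmulDr : right_distributive gmul +%R.
Proof.
move=> b a1 a2.
rewrite (gmulw (fsubset_refl _) (msuppD_le a1 a2)).
rewrite (gmulw (fsubset_refl (msupp b)) (fsubsetUl (msupp a1) (msupp a2))).
rewrite (gmulw (fsubset_refl (msupp b)) (fsubsetUr (msupp a1) (msupp a2))).
rewrite -big_split /=; apply: eq_bigr => x _.
rewrite -big_split /=; apply: eq_bigr => y _.
by rewrite mcoeffD mulrDr monalgUD.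
Qed.

Lemma gmul0l : left_zero 0 gmul.
Proof. by move=> a; apply: (addrI (gmul 0 a)); rewrite -gmulDl !addr0. Qed.

Lemma gmul0r : right_zero 0 gmul.
Proof. by move=> a; apply: (addrI (gmul a 0)); rewrite -gmulDr !addr0. Qed.

Lemma galg_ind (P : A -> Prop) :
  (forall x c, P (mkmalgU x c)) -> P 0 -> (forall a b, P a -> P b -> P (a + b)) ->
  forall a, P a.
Proof.
by move=> PU P0 PD a; rewrite [a]monalgE; elim/big_ind: _ => // x _; exact: PU.
Qed.

Lemma gmulA : associative gmul.
Proof.
move=> a b c.
elim/galg_ind: a => [x k||a1 a2 h1 h2]; last 2 first.
- by rewrite !gmul0l.
- by rewrite !gmulDl h1 h2.
elim/galg_ind: b => [y l||b1 b2 h1 h2]; last 2 first.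
- by rewrite gmul0l gmul0r gmul0l.
- by rewrite gmulDl !gmulDr gmulDl h1 h2.
elim/galg_ind: c => [z m||c1 c2 h1 h2]; last 2 first.
- by rewrite !gmul0r.
- by rewrite !gmulDr h1 h2.
by rewrite !gmulUU mulrA mulgA.
Qed.

Lemma gmul1l : left_id (gelt 1%g) gmul.
Proof.
elim/galg_ind => [x k||a1 a2 h1 h2]; first by rewrite gmulUU mul1r mul1g.
- by rewrite gmul0r.
- by rewrite gmulDr h1 h2.
Qed.

Lemma gmul1r : right_id (gelt 1%g) gmul.
Proof.
elim/galg_ind => [x k||a1 a2 h1 h2]; first by rewrite gmulUU mulr1 mulg1.
- by rewrite gmul0l.
- by rewrite gmulDl h1 h2.
Qed.

Lemma gelt1_neq0 : gelt 1%g != 0.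
Proof. by rewrite monalgU_eq0 oner_eq0. Qed.

HB.instance Definition _ := GRing.Zmodule_isNzRing.Build A
  gmulA gmul1l gmul1r gmulDl gmulDr gelt1_neq0.

Lemma scale_malgU (k c : K) x : k *: (mkmalgU x c : A) = mkmalgU x (k * c).
Proof. by apply/malgP => y; rewrite mcoeffZ !mcoeffU mulrnAr. Qed.

Lemma gscaleAl (k : K) a b : k *: (a * b) = (k *: a) * b.
Proof.
rewrite -[a * b]/(gmul a b) -[_ * b]/(gmul (k *: a) b).
elim/galg_ind: a => [x c||a1 a2 h1 h2]; last 2 first.
- by rewrite scaler0 gmul0l scaler0.
- by rewrite scalerDr !gmulDl scalerDr h1 h2.
elim/galg_ind: b => [y d||b1 b2 h1 h2]; last 2 first.
- by rewrite !gmul0r scaler0.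
- by rewrite !gmulDr scalerDr h1 h2.
by rewrite scale_malgU !gmulUU scale_malgU mulrA.
Qed.

HB.instance Definition _ := GRing.Lmodule_isLalgebra.Build K A gscaleAl.

Lemma gscaleAr (k : K) a b : k *: (a * b) = a * (k *: b).
Proof.
rewrite -[a * b]/(gmul a b) -[RHS]/(gmul a (k *: b)).
elim/galg_ind: b => [y d||b1 b2 h1 h2]; last 2 first.
- by rewrite scaler0 gmul0r scaler0.
- by rewrite scalerDr !gmulDr scalerDr h1 h2.
elim/galg_ind: a => [x c||a1 a2 h1 h2]; last 2 first.
- by rewrite !gmul0l scaler0.
- by rewrite !gmulDl scalerDr h1 h2.
by rewrite scale_malgU !gmulUU scale_malgU mulrCA.
Qed.

HB.instance Definition _ := GRing.Lalgebra_isAlgebra.Build K A gscaleAr.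

Definition augmentation a : K := \sum_(x <- msupp a) mcoeff x a.

Lemma augmentationw (d : {fset G}) a : (msupp a `<=` d)%fset -> augmentation a = \sum_(x <- d) mcoeff x a.
Proof.
by move=> le; apply: big_fset_incl => // x _ /mcoeff_outdom ->.
Qed.

Lemma augmentationU x c : augmentation (mkmalgU x c) = c.
Proof. by rewrite (augmentationw msuppU_le) big_seq_fset1 mcoeffUU. Qed.

Lemma augmentationD : {morph augmentation : a b / a + b}.
Proof.
move=> a b; rewrite (augmentationw (msuppD_le a b)).
rewrite (augmentationw (fsubsetUl _ (msupp b))) (augmentationw (fsubsetUr (msupp a) _)).
by rewrite -big_split; apply: eq_bigr => x _; rewrite mcoeffD.
Qed.

Lemma augmentation0 : augmentation 0 = 0.
Proof. by apply: (addrI (augmentation 0)); rewrite -augmentationD !addr0. Qed.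

Lemma augmentation_linear : linear_for *%R augmentation.
Proof.
move=> k a b; rewrite augmentationD; congr (_ + _).
elim/galg_ind: a => [x c||a1 a2 h1 h2]; first by rewrite scale_malgU !augmentationU.
- by rewrite scaler0 augmentation0 mulr0.
- by rewrite scalerDr !augmentationD h1 h2 mulrDr.
Qed.

HB.instance Definition _ := GRing.isLinear.Build K A K _ augmentation augmentation_linear.

Lemma augmentation_monoid_morphism : monoid_morphism augmentation.
Proof.
split=> [|a b]; first exact: augmentationU.
rewrite -[a * b]/(gmul a b).
elim/galg_ind: a => [x c||a1 a2 h1 h2]; last 2 first.
- by rewrite gmul0l augmentation0 mul0r.
- by rewrite gmulDl !augmentationD h1 h2 mulrDl.
elim/galg_ind: b => [y d||b1 b2 h1 h2]; last 2 first.
- by rewrite gmul0r augmentation0 mulr0.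
- by rewrite gmulDr !augmentationD h1 h2 mulrDr.
by rewrite gmulUU !augmentationU.
Qed.

HB.instance Definition _ := GRing.isMonoidMorphism.Build A K augmentation augmentation_monoid_morphism.

End GroupAlgebra.

Section GroupStarAlgebra.
Variables (C : numClosedFieldType) (G : groupType).
Local Notation A := (group_algebra C G).
Implicit Types (a b : A) (x y : G).

Definition gstar a : A := \sum_(x <- msupp a) mkmalgU x^-1%g (mcoeff x a)^*.

Lemma gstarw (d : {fset G}) a : (msupp a `<=` d)%fset ->
  gstar a = \sum_(x <- d) mkmalgU x^-1%g (mcoeff x a)^*.
Proof.
move=> le; apply: big_fset_incl => // x _ /mcoeff_outdom ->.
by rewrite conjC0 monalgU0.
Qed.

Lemma gstarU x (c : C) : gstar (mkmalgU x c) = mkmalgU x^-1%g c^*.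
Proof. by rewrite (gstarw msuppU_le) big_seq_fset1 mcoeffUU. Qed.

Lemma gstarD : {morph gstar : a b / a + b}.
Proof.
move=> a b; rewrite (gstarw (msuppD_le a b)).
rewrite (gstarw (fsubsetUl _ (msupp b))) (gstarw (fsubsetUr (msupp a) _)).
rewrite -big_split; apply: eq_bigr => x _ /=.
by rewrite mcoeffD rmorphD monalgUD.
Qed.

Lemma gstar0 : gstar 0 = 0.
Proof. by apply: (addrI (gstar 0)); rewrite -gstarD !addr0. Qed.

Lemma gstarZ (c : C) a : gstar (c *: a) = c^* *: gstar a.
Proof.
elim/galg_ind: a => [x d||a1 a2 h1 h2].
- by rewrite scale_malgU !gstarU scale_malgU rmorphM.
- by rewrite scaler0 gstar0 scaler0.
- by rewrite scalerDr !gstarD scalerDr h1 h2.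
Qed.

Lemma gstarM a b : gstar (a * b) = gstar b * gstar a.
Proof.
elim/galg_ind: a => [x c||a1 a2 h1 h2]; last 2 first.
- by rewrite mul0r gstar0 mulr0.
- by rewrite mulrDl !gstarD mulrDr h1 h2.
elim/galg_ind: b => [y d||b1 b2 h1 h2]; last 2 first.
- by rewrite mulr0 gstar0 mul0r.
- by rewrite mulrDr !gstarD mulrDl h1 h2.
rewrite !gstarU -[_ * _ in LHS]/(gmul _ _) -[RHS]/(gmul _ _) !gmulUU gstarU.
by rewrite rmorphM mulrC invgM.
Qed.

Lemma gstarK : involutive gstar.
Proof.
elim/galg_ind => [x c||a1 a2 h1 h2]; last 2 first.
- by rewrite !gstar0.
- by rewrite !gstarD h1 h2.
by rewrite !gstarU conjCK invgK.
Qed.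

HB.instance Definition _ := isStarAlgebra.Build C A gstarD gstarZ gstarM gstarK.

Lemma augmentation_star a : augmentation (star a) = (augmentation a)^*.
Proof.
rewrite -[star a]/(gstar a); elim/galg_ind: a => [x c||a1 a2 h1 h2].
- by rewrite gstarU !augmentationU.
- by rewrite gstar0 augmentation0 conjC0.
- by rewrite gstarD !augmentationD rmorphD h1 h2.
Qed.

End GroupStarAlgebra.

(* The forms of mathcomp are linear in their first argument, whereas inner    *)
(* products here are linear in the second one.                                *)
HB.mixin Record isPreHilbert (C : numClosedFieldType) D of GRing.Lmodule C D := {
  dotform : {dot D for @Num.conj C}
}.

#[short(type="preHilbertType")]
HB.structure Definition PreHilbert (C : numClosedFieldType) :=
  {D of GRing.Lmodule C D & isPreHilbert C D}.

Definition inner (C : numClosedFieldType) (D : preHilbertType C) (u v : D) : C :=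
  dotform v u.

Notation "⟨ u , v ⟩" := (inner u v) (format "⟨ u ,  v ⟩") : ring_scope.

HB.mixin Record PreHilbert_isHilbert (C : numClosedFieldType) H
    of PreHilbert C H & CompleteNormedModule C H := {
  sqr_norm_inner : forall u : H, `|u| ^+ 2 = ⟨u, u⟩
}.

#[short(type="hilbertType")]
HB.structure Definition Hilbert (C : numClosedFieldType) :=
  {H of PreHilbert C H & CompleteNormedModule C H & PreHilbert_isHilbert C H}.

Section LinearImage.
Variables (C : numClosedFieldType) (D : lmodType C) (H : preHilbertType C).
Variable f : {linear D -> H}.

Definition in_image : {pred H} := fun x => `[< exists v, f v = x >].

Lemma in_imageP x : reflect (exists v, f v = x) (x \in in_image).
Proof. exact: asboolP. Qed.

Record linear_image := LinearImage {
  image_val : H;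
  image_valP : image_val \in in_image
}.

HB.instance Definition _ := [isSub for image_val].
HB.instance Definition _ := [Choice of linear_image by <:].

Lemma in_image_closed : GRing.subsemimod_closed in_image.
Proof.
split; [split|].
- by apply/in_imageP; exists 0; rewrite linear0.
- move=> x y /in_imageP[u <-] /in_imageP[v <-].
  by apply/in_imageP; exists (u + v); rewrite linearD.
- move=> c x /in_imageP[u <-].
  by apply/in_imageP; exists (c *: u); rewrite linearZ.
Qed.

HB.instance Definition _ :=
  GRing.SubChoice_isSubLmodule.Build C H in_image linear_image in_image_closed.

Definition image_form (u v : linear_image) : C := dotform (val u) (val v).

Lemma image_form_bilinear :
  bilinear_for ( *%R : GRing.Scale.law C C) (Num.conj \; *%R : GRing.Scale.law C C)
    image_form.
Proof.
by split=> [z c u v|z c u v]; rewrite /image_form linearP ?linearPl ?linearPr.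
Qed.

HB.instance Definition _ := bilinear_isBilinear.Build C linear_image linear_image C
  _ _ image_form image_form_bilinear.

Lemma image_form_hermitian (u v : linear_image) :
  image_form u v = (-1) ^+ false * Num.conj (image_form v u).
Proof. exact: hermitian_subproof. Qed.

HB.instance Definition _ := isHermitianSesquilinear.Build C linear_image
  false (@Num.conj C) image_form image_form_hermitian.

Lemma image_form_gt0 (u : linear_image) : u != 0 -> 0 < image_form u u.
Proof.
move=> u0; apply: neq0_dnorm_gt0; apply: contra u0 => /eqP vu0.
by apply/eqP/val_inj; rewrite vu0 linear0.
Qed.

HB.instance Definition _ := isDotProduct.Build C linear_image image_form image_form_gt0.

HB.instance Definition _ := isPreHilbert.Build C linear_image image_form.

Lemma to_image_subproof v : f v \in in_image.
Proof. by apply/in_imageP; exists v. Qed.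

Definition to_image v : linear_image := LinearImage (to_image_subproof v).

Lemma to_image_linear : linear to_image.
Proof. by move=> c u v; apply/val_inj; rewrite [RHS]linearP /= linearP. Qed.

HB.instance Definition _ := GRing.isLinear.Build C D linear_image _ to_image to_image_linear.

End LinearImage.

Section SchuermannTriples.
Variables (C : numClosedFieldType) (A : starAlgType C).
Variable eps : {lrmorphism A -> C | *%R}.

Definition hermitian_functional (psi : {scalar A}) :=
  forall a, psi (star a) = (psi a)^*.

Record generating_functional (psi : {scalar A}) : Prop := {
  gen_one : psi 1 = 0;
  gen_hermitian : hermitian_functional psi;
  gen_pos : forall a, eps a = 0 -> 0 <= psi (star a * a)
}.

Section Triple.
Variables (D : preHilbertType C) (pi : A -> {linear D -> D}).
Variables (eta : {linear A -> D}) (psi : {scalar A}).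

Record star_representation : Prop := {
  rep_linear : forall (c : C) a b v, pi (c *: a + b) v = c *: pi a v + pi b v;
  rep_one : forall v, pi 1 v = v;
  rep_mul : forall a b v, pi (a * b) v = pi a (pi b v);
  rep_adjoint : forall a u v, ⟨pi a u, v⟩ = ⟨u, pi (star a) v⟩
}.

Definition cocycle := forall a b, eta (a * b) = pi a (eta b) + eps b *: eta a.

Record schuermann_triple : Prop := {
  triple_rep : star_representation;
  triple_cocycle : cocycle;
  triple_hermitian : hermitian_functional psi;
  triple_coboundary : forall a b,
    eps a * psi b - psi (a * b) + psi a * eps b = - ⟨eta (star a), eta b⟩
}.

End Triple.
End SchuermannTriples.

Section HilbertSubspaces.
Variables (C : numClosedFieldType) (H : hilbertType C).
Implicit Type S : set H.

Definition linear_span S : set H :=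
  [set x | exists n (c : 'I_n -> C) (s : 'I_n -> H),
     (forall i, S (s i)) /\ x = \sum_(i < n) c i *: s i].

Definition orthocomplement S : set H := [set x | forall y, S y -> ⟨y, x⟩ = 0].

Definition orthogonal_projection S (P : {linear H -> H}) :=
  forall x, S (P x) /\ orthocomplement S (x - P x).

End HilbertSubspaces.

Section LevyKhinchin.
Variables (C : numClosedFieldType) (A : starAlgType C).
Variable eps : {lrmorphism A -> C | *%R}.

Section Remainder.
Variables (D : preHilbertType C) (pi : A -> {linear D -> D}).
Variables (H : hilbertType C) (j : {linear D -> H}).

Record completion : Prop := {
  completion_isometry : forall u v, ⟨j u, j v⟩ = ⟨u, v⟩;
  completion_dense : dense (range j)
}.

Definition remainder_space : set H :=
  closure (linear_span [set j (pi a v - eps a *: v) | a in [set: A] & v in [set: D]]).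

Definition gaussian_space : set H := orthocomplement remainder_space.

End Remainder.

(* The data from which a decomposition of psi is sought. When psi is a        *)
(* generating functional, such data exist, the triple and the completion are  *)
(* unique up to unitary equivalence, and they determine the other fields;     *)
(* hence LK_decomposable does not depend on the choice of the data.           *)
Record LK_data (psi : {scalar A}) := {
  lkD : preHilbertType C;
  lk_pi : A -> {linear lkD -> lkD};
  lk_eta : {linear A -> lkD};
  lk_triple : schuermann_triple eps lk_pi lk_eta psi;
  lk_surj : forall v, exists a, lk_eta a = v;
  lkH : hilbertType C;
  lk_emb : {linear lkD -> lkH};
  lk_completion : completion lk_emb;
  lk_PG : {linear lkH -> lkH};
  lk_PGP : orthogonal_projection (gaussian_space lk_pi lk_emb) lk_PG;
  lk_PR : {linear lkH -> lkH};
  lk_PRP : orthogonal_projection (remainder_space lk_pi lk_emb) lk_PR;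
  lkDG := linear_image (lk_PG \o lk_emb);
  lkDR := linear_image (lk_PR \o lk_emb);
  lk_etaG : {linear A -> lkDG} := to_image (lk_PG \o lk_emb) \o lk_eta;
  lk_etaR : {linear A -> lkDR} := to_image (lk_PR \o lk_emb) \o lk_eta;
  lk_piG : A -> {linear lkDG -> lkDG};
  lk_piGE : forall a b, lk_piG a (lk_etaG b) = eps a *: lk_etaG b;
  lk_piR : A -> {linear lkDR -> lkDR};
  lk_piRE : forall a b, val (lk_piR a (lk_etaR b)) =
    lk_emb (lk_pi a (lk_eta b) - eps a *: lk_eta b) + eps a *: val (lk_etaR b)
}.

Definition LK_decomposable (psi : {scalar A}) (L : LK_data psi) :=
  exists psiG psiR : {scalar A},
    [/\ generating_functional eps psiG, generating_functional eps psiR,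
        forall a, psi a = psiG a + psiR a,
        schuermann_triple eps (@lk_piG psi L) (@lk_etaG psi L) psiG &
        schuermann_triple eps (@lk_piR psi L) (@lk_etaR psi L) psiR].

Definition admits_LK (psi : {scalar A}) := forall L : LK_data psi, LK_decomposable L.

Definition has_LK := forall psi : {scalar A},
  generating_functional eps psi -> admits_LK psi.

End LevyKhinchin.

(* Main.v *)
Require Import Defs.
From HB Require Import structures.
From mathcomp Require Import all_boot all_order all_algebra finmap.
From mathcomp Require Import complex.
From mathcomp Require Import boolp classical_sets functions reals.
From mathcomp Require Import topology normedtype.
From mathcomp Require Import -(notations) monalg.
From mathcomp Require Import ring lra.

(** A Schürmann triple on the group algebra of G extends linearly from group
data: a unitary representation U, a U-cocycle e and a function p with
p (g^-1) = p(g)^* and p (gh) = p g + p h + <e (g^-1), e h> (lemma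
[group_triple]).  These identities force Re (p g) = - <e g, e g> / 2, so such
data amount to a homomorphism from G into a Heisenberg-like group, whose
elements carry a unitary, a vector and a real number, the imaginary part of p.  On a surface group such a homomorphism is
determined by the images of the generators, and the only condition on them is
that the product of the k commutators be trivial.

For a Gaussian triple (U trivial, e a homomorphism into the additive group of
D), the function p takes the value <e h, e g> - <e g, e h> on the commutator of
g and h and is additive on commutators.  The surface relation therefore forces
  sum_i (<e b_i, e a_i> - <e a_i, e b_i>) = 0
(lemma [gaussian_surface_obstruction]).  This is the obstruction in the second
cohomology of the surface.

A cocycle with Gaussian and non-Gaussian parts has to cancel only the sum of
their obstructions.  So let Gamma_k act on C^2 by 1 on the first coordinate and
by a sign character on the second one, where only a_2 has sign -1 (this is where
genus at least 2 enters), and let the cocycle be (1, 1) at a_1, (i, -i) at b_1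
and 0 at the other generators.  The two vectors are orthogonal, so the images of
a_1 and b_1 commute in the Heisenberg-like group and the triple exists, with a
surjective cocycle.  But the first coordinate alone is Gaussian with
obstruction -2i, so the Gaussian part of this triple has no generating
functional.

The remaining work is to present C^2 as a Hilbert space and to identify the
remainder space of this triple with the second axis and its orthocomplement
with the first one. *)

Set Implicit Arguments.
Unset Strict Implicit.
Unset Printing Implicit Defensive.

Import Order.TTheory GRing.Theory Num.Theory.
Import numFieldNormedType.Exports.

Local Open Scope ring_scope.
Local Open Scope classical_set_scope.

(** * Inner products *)

Section InnerTheory.
Variables (C : numClosedFieldType) (D : preHilbertType C).
Implicit Types u v w : D.

Lemma innerDl u v w : ⟨u + v, w⟩ = ⟨u, w⟩ + ⟨v, w⟩.
Proof. exact: linearDr. Qed.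

Lemma innerDr u v w : ⟨u, v + w⟩ = ⟨u, v⟩ + ⟨u, w⟩.
Proof. exact: linearDl. Qed.

Lemma innerZl (c : C) u v : ⟨c *: u, v⟩ = c^* * ⟨u, v⟩.
Proof. exact: linearZr_LR. Qed.

Lemma innerZr (c : C) u v : ⟨u, c *: v⟩ = c * ⟨u, v⟩.
Proof. exact: linearZl_LR. Qed.

Lemma inner0l v : ⟨0, v⟩ = 0.
Proof. exact: linear0r. Qed.

Lemma inner0r v : ⟨v, 0⟩ = 0.
Proof. exact: linear0l. Qed.

Lemma innerNl u v : ⟨- u, v⟩ = - ⟨u, v⟩.
Proof. exact: linearNr. Qed.

Lemma innerNr u v : ⟨u, - v⟩ = - ⟨u, v⟩.
Proof. exact: linearNl. Qed.

Lemma innerC u v : ⟨u, v⟩ = ⟨v, u⟩^*.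
Proof. by rewrite /inner hermC expr0 mul1r. Qed.

Lemma inner_ge0 u : 0 <= ⟨u, u⟩.
Proof. exact: dnorm_ge0. Qed.

End InnerTheory.

(** * The Hilbert space C^2 *)

(** An alias of the product, so that the product norm (a maximum) is not
inherited and the Euclidean norm can be installed. *)
Definition hplane (R : realType) : Type := (R[i]^o * R[i]^o)%type.

Section HermitianPlane.
Variable R : realType.
Local Notation C := R[i].
Local Notation H := (hplane R).
Implicit Types x y : H.

HB.instance Definition _ := Vector.copy H (C^o * C^o)%type.

Definition hplane_form x y : C := x.1 * y.1^* + x.2 * y.2^*.

Lemma hplane_form_bilinear :
  bilinear_for ( *%R : GRing.Scale.law C C) (Num.conj \; *%R : GRing.Scale.law C C)
    hplane_form.
Proof.
by split=> [z c u v|z c u v]; rewrite /hplane_form /= -[c *: u.1]/(c * u.1)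
  -[c *: u.2]/(c * u.2) ?rmorphD ?rmorphM /=; ring.
Qed.

HB.instance Definition _ := bilinear_isBilinear.Build C H H C
  _ _ hplane_form hplane_form_bilinear.

Lemma hplane_form_hermitian x y :
  hplane_form x y = (-1) ^+ false * Num.conj (hplane_form y x).
Proof.
by rewrite expr0 mul1r rmorphD !rmorphM /= !conjCK /hplane_form ![_^* * _]mulrC.
Qed.

HB.instance Definition _ := isHermitianSesquilinear.Build C H
  false (@Num.conj C) hplane_form hplane_form_hermitian.

Lemma hplane_formE x : hplane_form x x = `|x.1| ^+ 2 + `|x.2| ^+ 2.
Proof. by rewrite !normCK. Qed.

Lemma hplane_form_gt0 x : x != 0 -> 0 < hplane_form x x.
Proof.
move=> x0; rewrite hplane_formE lt_def addr_ge0 ?exprn_ge0 // andbT.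
rewrite paddr_eq0 ?exprn_ge0 // !sqrf_eq0 !normr_eq0.
by apply: contra x0 => /andP[/eqP x1 /eqP x2]; case: x x1 x2 => a b /= -> ->.
Qed.

HB.instance Definition _ := isDotProduct.Build C H hplane_form hplane_form_gt0.

HB.instance Definition _ := isPreHilbert.Build C H hplane_form.

Lemma innerE x y : ⟨x, y⟩ = x.1^* * y.1 + x.2^* * y.2.
Proof. by rewrite /inner /= /hplane_form (mulrC y.1) (mulrC y.2). Qed.

Definition hnorm x : C := sqrtC (hplane_form x x).

(** The triangle inequality comes from the dot product [hplane_form], by
Cauchy-Schwarz. *)
Lemma hnormD x y : hnorm (x + y) <= hnorm x + hnorm y.
Proof. exact: triangle_lerif. Qed.

Lemma hnormZ (c : C) x : hnorm (c *: x) = `|c| * hnorm x.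
Proof.
rewrite /hnorm !hplane_formE /= !normrM !exprMn -mulrDr.
by rewrite sqrtCM ?nnegrE ?addr_ge0 ?exprn_ge0 // sqrCK.
Qed.

Lemma hnorm_eq0 x : hnorm x = 0 -> x = 0.
Proof.
move=> /eqP; rewrite sqrtC_eq0 => x0; apply/eqP.
by apply: contraTT x0 => /hplane_form_gt0; rewrite lt_def => /andP[].
Qed.

HB.instance Definition _ := @Lmodule_isNormed.Build C H hnorm hnormD hnormZ hnorm_eq0.

Lemma hplane_sqr_norm x : `|x| ^+ 2 = ⟨x, x⟩.
Proof. by rewrite sqrtCK. Qed.

Lemma coord1_le x : `|x.1 : C| <= `|x|.
Proof.
rewrite -[_ <= _]ler_sqr ?nnegrE // hplane_sqr_norm [⟨_, _⟩]hplane_formE.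
by rewrite lerDl exprn_ge0.
Qed.

Lemma coord2_le x : `|x.2 : C| <= `|x|.
Proof.
rewrite -[_ <= _]ler_sqr ?nnegrE // hplane_sqr_norm [⟨_, _⟩]hplane_formE.
by rewrite lerDr exprn_ge0.
Qed.

Lemma norm_le_coord x : `|x| <= `|x.1 : C| + `|x.2 : C|.
Proof.
rewrite -[_ <= _]ler_sqr ?nnegrE ?addr_ge0 // hplane_sqr_norm.
rewrite [⟨_, _⟩]hplane_formE sqrrD addrAC lerDl.
by rewrite mulrn_wge0 // mulr_ge0.
Qed.

Lemma normReB_le (z w : C) : (`|complex.Re z - complex.Re w|)%:C%C <= `|z - w|.
Proof.
case: z w => [a b] [c d]; rewrite normc_def lecR -sqrtr_sqr ler_wsqrtr //=.
by rewrite lerDl sqr_ge0.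
Qed.

Lemma normImB_le (z w : C) : (`|complex.Im z - complex.Im w|)%:C%C <= `|z - w|.
Proof.
case: z w => [a b] [c d]; rewrite normc_def lecR -sqrtr_sqr ler_wsqrtr //=.
by rewrite lerDr sqr_ge0.
Qed.

Lemma norm_le_ReIm (z : C) :
  `|z| <= (`|complex.Re z| + `|complex.Im z|)%:C%C.
Proof.
rewrite normc_def lecR -[leRHS]ger0_norm ?addr_ge0 // -sqrtr_sqr.
rewrite ler_wsqrtr // sqrrD !real_normK ?num_real // addrAC lerDl.
by rewrite mulrn_wge0 // mulr_ge0.
Qed.

(** Completeness is reduced to that of R, one real coordinate at a time. *)
Lemma cauchy_coord_cvg (F : set_system H) (f : H -> R) :
  ProperFilter F -> cauchy F ->
  (forall x y, (`|f x - f y|)%:C%C <= `|x - y|) ->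
  exists l, forall e : R, 0 < e -> \forall x \near F, `|l - f x| < e.
Proof.
move=> FF cF flip.
have /R_complete cf : cauchy (f @ F).
  apply/cauchy_exP => e e0.
  have [|x Fx] := (cauchyP F).1 cF e%:C%C; first by rewrite ltcR.
  exists (f x); rewrite -[_ (ball _ _)]/(F (f @^-1` ball (f x) e)).
  apply: filterS Fx => y /=.
  by rewrite -!ball_normE /ball_ /= -ltcR; apply: le_lt_trans.
exists (lim (f @ F)) => e e0.
exact: (@cvgr_dist_lt _ _ _ _ _ f _ cf).
Qed.

Lemma hplane_complete (F : set_system H) : ProperFilter F -> cauchy F -> cvg F.
Proof.
move=> FF cF.
have [a Fa] := cauchy_coord_cvg (f := fun x => complex.Re x.1) FF cF
  (fun x y => le_trans (normReB_le _ _) (coord1_le (x - y))).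
have [b Fb] := cauchy_coord_cvg (f := fun x => complex.Im x.1) FF cF
  (fun x y => le_trans (normImB_le _ _) (coord1_le (x - y))).
have [c Fc] := cauchy_coord_cvg (f := fun x => complex.Re x.2) FF cF
  (fun x y => le_trans (normReB_le _ _) (coord2_le (x - y))).
have [d Fd] := cauchy_coord_cvg (f := fun x => complex.Im x.2) FF cF
  (fun x y => le_trans (normImB_le _ _) (coord2_le (x - y))).
apply/cvg_ex; exists ((a +i* b, c +i* d)%C : H).
apply/fcvgrPdist_lt => e e0.
(* In R[i] only real numbers are positive. *)
have [r r0 ->] : exists2 r : R, 0 < r & e = r%:C%C.
  have /complex_realP[r er] := gtr0_real e0.
  by exists r => //; rewrite -ltcR -er.
have r4 : 0 < r / 4 by rewrite divr_gt0.
near=> x.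
apply: le_lt_trans (norm_le_coord _) _.
apply: le_lt_trans (lerD (norm_le_ReIm _) (norm_le_ReIm _)) _.
rewrite -rmorphD /= ltcR.
have ax : `|a - complex.Re x.1| < r / 4 by near: x; exact: Fa.
have bx : `|b - complex.Im x.1| < r / 4 by near: x; exact: Fb.
have cx : `|c - complex.Re x.2| < r / 4 by near: x; exact: Fc.
have dx : `|d - complex.Im x.2| < r / 4 by near: x; exact: Fd.
move: ax bx cx dx; case: x.1 x.2 => [? ?] [? ?] /=; lra.
Unshelve. all: by end_near. Qed.

HB.instance Definition _ := Uniform_isComplete.Build H hplane_complete.
HB.instance Definition _ := PreHilbert_isHilbert.Build C H hplane_sqr_norm.

End HermitianPlane.

(** * Group data on a group algebra *)

Section LinearExtension.
Variables (K : comNzRingType) (G : groupType).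
Local Notation A := (group_algebra K G).
Implicit Types (a b : A) (g h : G).

Lemma geltM g h : gelt K g * gelt K h = gelt K (g * h)%g.
Proof. by rewrite -[LHS]/(gmul _ _) gmulUU mulr1. Qed.

Lemma malgUE g (c : K) : mkmalgU g c = c *: (gelt K g : A).
Proof. by rewrite scale_malgU mulr1. Qed.

Lemma galg_lin_ind (P : A -> Prop) :
  (forall g, P (gelt K g)) -> P 0 -> (forall (c : K) a, P a -> P (c *: a)) ->
  (forall a b, P a -> P b -> P (a + b)) -> forall a, P a.
Proof.
move=> Pg P0 PZ PD; elim/galg_ind => [g c||]//.
by rewrite malgUE; exact: PZ.
Qed.

Section Vectorial.
Variables (V : lmodType K) (f : G -> V).

Definition gext a : V := \sum_(g <- msupp a) mcoeff g a *: f g.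

Lemma gextw (d : {fset G}) a : (msupp a `<=` d)%fset ->
  gext a = \sum_(g <- d) mcoeff g a *: f g.
Proof.
by move=> le; apply: big_fset_incl => // g _ /mcoeff_outdom ->; rewrite scale0r.
Qed.

Lemma gext_linear : linear gext.
Proof.
move=> c a b; pose d := (msupp (c *: a + b) `|` (msupp a `|` msupp b))%fset.
rewrite !(@gextw d) ?fsubsetUl //; last 2 first.
- by rewrite (fsubset_trans _ (fsubsetUr _ _)) ?fsubsetUr.
- by rewrite (fsubset_trans _ (fsubsetUr _ _)) ?fsubsetUl.
rewrite scaler_sumr -big_split; apply: eq_bigr => g _ /=.
by rewrite mcoeffD mcoeffZ scalerDl scalerA.
Qed.

HB.instance Definition _ := GRing.isLinear.Build K A V _ gext gext_linear.

Lemma gext_comb (c d : K) a b : gext (c *: a + d *: b) = c *: gext a + d *: gext b.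
Proof. by rewrite linearD !linearZ. Qed.

Lemma gextE g : gext (gelt K g) = f g.
Proof. by rewrite (gextw msuppU_le) big_seq_fset1 mcoeffUU scale1r. Qed.

End Vectorial.

(** The case of a functional: [gext] takes values in the regular module, whose
scaling has to be read as multiplication. *)
Definition gfun (p : G -> K) (a : A) : K := gext (p : G -> K^o) a.

Lemma gfun_linear p : linear_for *%R (gfun p).
Proof. by move=> c a b; rewrite /gfun linearP. Qed.

HB.instance Definition _ p := GRing.isLinear.Build K A K _ (gfun p) (gfun_linear p).

Lemma gfunE p g : gfun p (gelt K g) = p g.
Proof. by rewrite [LHS]gextE. Qed.

Section Operators.
Variables (V : lmodType K) (U : G -> {linear V -> V}).

Definition gact a (v : V) : V := gext (U ^~ v) a.

Lemma gact_linear a : linear (gact a).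
Proof.
move=> c v w; rewrite /gact /gext scaler_sumr -big_split; apply: eq_bigr => g _ /=.
by rewrite linearP scalerDr !scalerA mulrC.
Qed.

HB.instance Definition _ a := GRing.isLinear.Build K V V _ (gact a) (gact_linear a).

Lemma gact_linearl (c : K) a b v : gact (c *: a + b) v = c *: gact a v + gact b v.
Proof. exact: linearP. Qed.

Lemma gact0l v : gact 0 v = 0.
Proof. exact: linear0. Qed.

Lemma gactDl a b v : gact (a + b) v = gact a v + gact b v.
Proof. exact: linearD. Qed.

Lemma gactZl (c : K) a v : gact (c *: a) v = c *: gact a v.
Proof. exact: linearZ. Qed.

Lemma gactE g v : gact (gelt K g) v = U g v.
Proof. by rewrite [LHS]gextE. Qed.

End Operators.
End LinearExtension.

Lemma augmentation_gelt (K : comNzRingType) (G : groupType) (g : G) :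
  augmentation (gelt K g) = 1.
Proof. exact: augmentationU. Qed.

Lemma star_gelt (C : numClosedFieldType) (G : groupType) (g : G) :
  star (gelt C g) = gelt C g^-1%g.
Proof. by rewrite -[star _]/(gstar _) gstarU conjC1. Qed.

Section TripleTheory.
Variables (C : numClosedFieldType) (A : starAlgType C).
Variable eps : {lrmorphism A -> C | *%R}.
Hypothesis eps_star : forall a, eps (star a) = (eps a)^*.

(** On the kernel of [eps] the coboundary identity reads
psi (a^* a) = <eta a, eta a>. *)
Lemma triple_generating (D : preHilbertType C) (pi : A -> {linear D -> D})
    (eta : {linear A -> D}) (psi : {scalar A}) :
  schuermann_triple eps pi eta psi -> generating_functional eps psi.
Proof.
case=> -[_ rep1 _ _] coc herm cob.
have eta1 : eta 1 = 0.
  by apply: (addrI (eta 1)); rewrite addr0 -{3}[1](mulr1 1) coc rep1 rmorph1 scale1r.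
split=> // [|a a0].
- have := cob 1 1; rewrite mulr1 rmorph1 mul1r mulr1 eta1 inner0r oppr0.
  by rewrite subrr add0r.
have := cob (star a) a; rewrite eps_star a0 conjC0 mul0r mulr0 addr0 sub0r starK.
by move/oppr_inj=> ->; exact: inner_ge0.
Qed.

End TripleTheory.

Section GroupTriple.
Variables (C : numClosedFieldType) (G : groupType) (D : preHilbertType C).
Variables (U : G -> {linear D -> D}) (e : G -> D) (p : G -> C).
Local Notation A := (group_algebra C G).

Hypothesis U1 : forall v, U 1%g v = v.
Hypothesis UM : forall g h v, U (g * h)%g v = U g (U h v).
Hypothesis Uadj : forall g u v, ⟨U g u, v⟩ = ⟨u, U g^-1%g v⟩.
Hypothesis eM : forall g h, e (g * h)%g = U g (e h) + e g.
Hypothesis pV : forall g, p g^-1%g = (p g)^*.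
Hypothesis pM : forall g h, p (g * h)%g = p g + p h + ⟨e g^-1%g, e h⟩.

Lemma gactM a b v : gact U (a * b) v = gact U a (gact U b v).
Proof.
elim/galg_lin_ind: a => [g||c a IH|a a' IH IH'].
- elim/galg_lin_ind: b => [h||c b IH|b b' IH IH'].
  + by rewrite geltM !gactE UM.
  + by rewrite mulr0 !gact0l linear0.
  + by rewrite -scalerAr !gactZl linearZ IH.
  + by rewrite mulrDr !gactDl linearD IH IH'.
- by rewrite mul0r !gact0l.
- by rewrite -scalerAl !gactZl IH.
- by rewrite mulrDl !gactDl IH IH'.
Qed.

Lemma gact_adjoint a u v : ⟨gact U a u, v⟩ = ⟨u, gact U (star a) v⟩.
Proof.
elim/galg_lin_ind: a => [g||c a IH|a a' IH IH'].
- by rewrite star_gelt !gactE Uadj.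
- by rewrite -[star 0]/(gstar 0) gstar0 !gact0l inner0l inner0r.
- by rewrite starZ !gactZl innerZl innerZr IH.
- by rewrite starD !gactDl innerDl innerDr IH IH'.
Qed.

Lemma gext_cocycle (a b : A) :
  gext e (a * b) = gact U a (gext e b) + augmentation b *: gext e a.
Proof.
elim/galg_lin_ind: a => [g||c a IH|a a' IH IH'].
- elim/galg_lin_ind: b => [h||c b IH|b b' IH IH'].
  + by rewrite geltM !gextE gactE eM augmentation_gelt scale1r.
  + by rewrite mulr0 !linear0 scale0r addr0.
  + by rewrite -scalerAr !linearZ /= IH scalerDr scalerA.
  + by rewrite mulrDr !linearD /= IH IH' scalerDl addrACA.
- by rewrite mul0r gact0l !linear0 addr0.
- by rewrite -scalerAl gactZl !linearZ /= IH scalerDr !scalerA mulrC.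
- by rewrite mulrDl gactDl !linearD /= IH IH' addrACA.
Qed.

Lemma gfun_hermitian (a : A) : gfun p (star a) = (gfun p a)^*.
Proof.
elim/galg_lin_ind: a => [g||c a IH|a a' IH IH'].
- by rewrite star_gelt !gfunE pV.
- by rewrite -[star 0]/(gstar 0) gstar0 linear0 conjC0.
- by rewrite starZ !linearZ rmorphM /= IH.
- by rewrite starD !linearD rmorphD /= IH IH'.
Qed.

Lemma gfun_coboundary (a b : A) :
  augmentation a * gfun p b - gfun p (a * b) + gfun p a * augmentation b =
  - ⟨gext e (star a), gext e b⟩.
Proof.
elim/galg_lin_ind: a => [g||c a IH|a a' IH IH'].
- elim/galg_lin_ind: b => [h||c b IH|b b' IH IH'].
  + by rewrite star_gelt geltM !gextE !gfunE pM !augmentation_gelt; ring.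
  + by rewrite mulr0 !linear0 inner0r !(mulr0, oppr0, addr0).
  + by rewrite -scalerAr !linearZ /= innerZr -[c *: - _]/(c * - _) -mulrN -IH; ring.
  + by rewrite mulrDr !linearD /= innerDr opprD -IH -IH'; ring.
- rewrite -[star 0]/(gstar 0) gstar0 mul0r !linear0 inner0l.
  by rewrite !(mul0r, oppr0, addr0).
- rewrite starZ -scalerAl !linearZ /= innerZl conjCK.
  by rewrite -[c *: - _]/(c * - _) -mulrN -IH; ring.
- by rewrite starD mulrDl !linearD /= innerDl opprD -IH -IH'; ring.
Qed.

(** Both sides of each axiom of a triple are linear in each algebra element, so
it suffices to check them on group elements. *)
Lemma group_triple :
  schuermann_triple (@augmentation C G) (fun a : A => gact U a)
    (gext e : {linear A -> D}) (gfun p : {scalar A}).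
Proof.
split; [split| | |].
- exact: gact_linearl.
- by move=> v; rewrite -[1]/(gelt C 1%g : A) [LHS]gactE U1.
- exact: gactM.
- exact: gact_adjoint.
- exact: gext_cocycle.
- exact: gfun_hermitian.
- exact: gfun_coboundary.
Qed.

End GroupTriple.

(** * Homomorphisms out of a presented group *)

Section UniversalProperty.
Variables (X : choiceType) (rels : set (seq (X * bool))) (G : groupType).
Variable f : X -> G.

Definition word_eval (w : seq (X * bool)) : G :=
  foldr (fun l g => (if l.2 then f l.1 else (f l.1)^-1) * g)%g 1%g w.

Lemma word_eval_cat u v : word_eval (u ++ v) = (word_eval u * word_eval v)%g.
Proof. by elim: u => [|l u IH] /=; rewrite ?mul1g // IH mulgA. Qed.

Hypothesis relsP : forall r, rels r -> word_eval r = 1%g.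

Lemma word_eval_pres u v : pres_eq rels u v -> word_eval u = word_eval v.
Proof.
elim=> {u v} [|//|u v w _ -> _ -> //|u u' v v' _ uE _ vE|x b|r /relsP //] //.
  by rewrite !word_eval_cat uE vE.
by case: b => /=; rewrite mulg1 ?mulgV ?mulVg.
Qed.

Definition pres_lift (g : presented rels) : G := word_eval (repr g).

Lemma pres_liftE w : pres_lift (pres_class rels w) = word_eval w.
Proof. exact/word_eval_pres/pres_reprK. Qed.

Lemma pres_liftM g h : pres_lift (g * h)%g = (pres_lift g * pres_lift h)%g.
Proof.
have [u ->] := pres_surj g; have [v ->] := pres_surj h.
by rewrite -[(_ * _)%g]/(pres_mul _ _) pres_mulE !pres_liftE word_eval_cat.
Qed.

Lemma pres_lift_gen x : pres_lift (pres_class rels [:: (x, true)]) = f x.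
Proof. by rewrite pres_liftE /= mulg1. Qed.

End UniversalProperty.

(** * The obstruction for Gaussian triples on surface groups *)

Section GaussianTriple.
Variables (C : numClosedFieldType) (G : groupType) (D : preHilbertType C).
Local Notation A := (group_algebra C G).
Variables (pi : A -> {linear D -> D}) (eta : {linear A -> D}) (psi : {scalar A}).
Hypothesis triple : schuermann_triple (@augmentation C G) pi eta psi.
Hypothesis gaussian : forall a b, pi a (eta b) = augmentation a *: eta b.
Implicit Types g h : G.

Lemma gaussian_etaM g h :
  eta (gelt C (g * h)%g) = eta (gelt C g) + eta (gelt C h).
Proof.
by rewrite -geltM (triple_cocycle triple) /= gaussian !augmentation_gelt !scale1r addrC.
Qed.

Lemma gaussian_eta1 : eta (gelt C 1%g) = 0.
Proof. by apply: (addrI (eta (gelt C 1%g))); rewrite -gaussian_etaM mulg1 addr0. Qed.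

Lemma gaussian_etaV g : eta (gelt C g^-1%g) = - eta (gelt C g).
Proof. by apply/eqP; rewrite -addr_eq0 -gaussian_etaM mulVg gaussian_eta1. Qed.

Lemma gaussian_psiM g h : psi (gelt C (g * h)%g) =
  psi (gelt C g) + psi (gelt C h) - ⟨eta (gelt C g), eta (gelt C h)⟩.
Proof.
have := triple_coboundary triple (gelt C g) (gelt C h).
rewrite /= !augmentation_gelt star_gelt gaussian_etaV geltM mul1r mulr1.
rewrite innerNl opprK => <-; ring.
Qed.

Lemma gaussian_psi1 : psi (gelt C 1%g) = 0.
Proof.
have := gaussian_psiM 1%g 1%g; rewrite mulg1 gaussian_eta1 inner0l subr0 => H.
by apply: (addrI (psi (gelt C 1%g))); rewrite -H addr0.
Qed.

(** With c the commutator, c (hg) = gh and eta c = 0, so psi c is the difference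
psi (gh) - psi (hg), in which only the inner products survive. *)
Lemma gaussian_psi_commutator g h (c := (g * h * g^-1 * h^-1)%g) :
  eta (gelt C c) = 0 /\
  psi (gelt C c) =
    ⟨eta (gelt C h), eta (gelt C g)⟩ - ⟨eta (gelt C g), eta (gelt C h)⟩.
Proof.
have eta_c : eta (gelt C c) = 0.
  rewrite !gaussian_etaM !gaussian_etaV; set x := eta _; set y := eta _.
  by rewrite [x + y]addrC addrK subrr.
split=> //; have := gaussian_psiM c (h * g)%g.
have -> : (c * (h * g) = g * h)%g by rewrite /c !mulgA !mulgVK.
rewrite eta_c inner0l subr0 !gaussian_psiM => H.
apply: (addIr (psi (gelt C h) + psi (gelt C g) - ⟨eta (gelt C h), eta (gelt C g)⟩)).
rewrite -H; ring.
Qed.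

End GaussianTriple.

Section SurfaceGroup.
Variable k : nat.

Definition surface_class (w : seq (('I_k + 'I_k) * bool)) : surface_group k :=
  pres_class _ w.

Lemma surface_classM u v :
  (surface_class u * surface_class v)%g = surface_class (u ++ v).
Proof. exact: pres_mulE. Qed.

Lemma surface_classV u : (surface_class u)^-1%g = surface_class (winv u).
Proof. exact: pres_invE. Qed.

Definition surface_gen (x : 'I_k + 'I_k) : surface_group k :=
  surface_class [:: (x, true)].

End SurfaceGroup.

Section SurfaceObstruction.
Variables (C : numClosedFieldType) (k : nat) (D : preHilbertType C).
Local Notation A := (group_algebra C (surface_group k)).
Variables (pi : A -> {linear D -> D}) (eta : {linear A -> D}) (psi : {scalar A}).
Hypothesis triple : schuermann_triple (@augmentation C (surface_group k)) pi eta psi.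
Hypothesis gaussian : forall a b, pi a (eta b) = augmentation a *: eta b.
Let ea (i : 'I_k) := eta (gelt C (surface_gen (inl i))).
Let eb (i : 'I_k) := eta (gelt C (surface_gen (inr i))).

(** psi is additive on products of commutators, where eta vanishes; evaluate
it on the surface relator, which represents 1. *)
Lemma gaussian_surface_obstruction :
  \sum_(i < k) (⟨eb i, ea i⟩ - ⟨ea i, eb i⟩) = 0.
Proof.
pose w (s : seq 'I_k) : seq (('I_k + 'I_k) * bool) := flatten
  [seq [:: (inl i, true); (inr i, true); (inl i, false); (inr i, false)] | i <- s].
pose cw s := surface_class (w s).
have psi_w s : eta (gelt C (cw s)) = 0 /\
    psi (gelt C (cw s)) = \sum_(i <- s) (⟨eb i, ea i⟩ - ⟨ea i, eb i⟩).
  elim: s => [|i s [IHeta IHpsi]].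
    rewrite big_nil /cw /w /= -[surface_class _]/(1%g : surface_group k).
    by rewrite (gaussian_eta1 triple) // (gaussian_psi1 triple).
  pose a := surface_gen (inl i); pose b := surface_gen (inr i).
  have -> : cw (i :: s) = (a * b * a^-1 * b^-1 * cw s)%g.
    by rewrite /a /b /surface_gen !surface_classV !surface_classM.
  have [eta_c psi_c] := gaussian_psi_commutator triple gaussian a b.
  rewrite (gaussian_etaM triple) // eta_c IHeta addr0; split=> //.
  by rewrite (gaussian_psiM triple) // psi_c IHpsi eta_c inner0l subr0 big_cons.
have := (psi_w (enum 'I_k)).2; rewrite big_enum /= => <-.
have -> : cw (enum 'I_k) = 1%g by apply/pres_classP/pres_rel.
exact: (gaussian_psi1 triple).
Qed.

End SurfaceObstruction.

(** * The Heisenberg-like group over the twisted plane *)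

Section Twist.
Variable R : realType.
Local Notation C := R[i].
Local Notation H := (hplane R).
Implicit Types (s : bool) (x y : H).

Definition twist s x : H := (x.1, (-1) ^+ s * x.2).

Lemma twist_linear s : linear (twist s).
Proof.
move=> c x y; congr (_, _).
by rewrite [LHS]mulrDr /= -[c *: x.2]/(c * x.2) mulrCA.
Qed.

HB.instance Definition _ s := GRing.isLinear.Build C H H _ (twist s) (twist_linear s).

Lemma twistD s x y : twist s (x + y) = twist s x + twist s y.
Proof. exact: linearD. Qed.

Lemma twist0 x : twist false x = x.
Proof. by case: x => u v; rewrite /twist expr0 mul1r. Qed.

Lemma twistM s s' x : twist (s (+) s') x = twist s (twist s' x).
Proof. by rewrite /twist signr_addb /= mulrA. Qed.

Lemma twistK s : involutive (twist s).
Proof. by move=> x; rewrite -twistM addbb twist0. Qed.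

Lemma inner_twist s x y : ⟨twist s x, y⟩ = ⟨x, twist s y⟩.
Proof. by rewrite !innerE /= rmorphM rmorph_sign mulrCA mulrA. Qed.

Lemma ImD (z w : C) : complex.Im (z + w) = complex.Im z + complex.Im w.
Proof. by case: z w => [? ?] [? ?]. Qed.

Lemma Im_innerDl x y z :
  complex.Im ⟨x + y, z⟩ = complex.Im ⟨x, z⟩ + complex.Im ⟨y, z⟩.
Proof. by rewrite innerDl ImD. Qed.

Lemma Im_innerDr x y z :
  complex.Im ⟨x, y + z⟩ = complex.Im ⟨x, y⟩ + complex.Im ⟨x, z⟩.
Proof. by rewrite innerDr ImD. Qed.

Lemma Im_innerN x : complex.Im (- ⟨x, x⟩) = 0.
Proof. by case: ⟨x, x⟩ (ger0_Im (inner_ge0 x)) => a b /= ->; rewrite oppr0. Qed.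

Lemma conj_Im (z : C) : z^* = z - 2 * ('i * (complex.Im z)%:C)%C.
Proof.
case: z => a b; apply/eqP; rewrite eq_complex /=; apply/andP; split; apply/eqP; ring.
Qed.

(** A triple (s, x, t) records the values at one group element of a Schürmann
triple on C^2: the operator [twist s], the cocycle x, and the imaginary part t
of the functional, whose real part must be - <x, x> / 2.  The product below is
the one for which the projections to these three values satisfy the conditions
on group data. *)
Definition cocycle_group : Type := (bool * H * R)%type.
Local Notation T := cocycle_group.
HB.instance Definition _ := Choice.copy T (bool * H * R)%type.

Definition cg_mul (g h : T) : T :=
  let: (s, x, t) := g in let: (s', x', t') := h in
  (s (+) s', x + twist s x', t + t' - complex.Im ⟨x, twist s x'⟩).
Definition cg_one : T := (false, 0, 0).
Definition cg_inv (g : T) : T := let: (s, x, t) := g in (s, - twist s x, - t).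

Lemma cg_mulA : associative cg_mul.
Proof.
move=> [[s x] t] [[s' x'] t'] [[s'' x''] t''] /=; rewrite addbA; congr (_, _, _).
  by rewrite twistD addrA twistM.
rewrite twistM twistD Im_innerDl Im_innerDr [⟨twist s x', _⟩]inner_twist twistK.
by ring.
Qed.

Lemma cg_mul1g : left_id cg_one cg_mul.
Proof. by move=> [[s x] t] /=; rewrite twist0 inner0l !add0r subr0. Qed.

Lemma cg_mulg1 : right_id cg_one cg_mul.
Proof.
by move=> [[s x] t] /=; rewrite linear0 inner0r !addr0 subr0 addbF.
Qed.

Lemma cg_mulVg : left_inverse cg_one cg_inv cg_mul.
Proof.
move=> [[s x] t] /=; rewrite addbb addNr; congr (_, _, _).
by rewrite innerNl inner_twist twistK addNr sub0r Im_innerN oppr0.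
Qed.

Lemma cg_mulgV : right_inverse cg_one cg_inv cg_mul.
Proof.
move=> [[s x] t] /=; rewrite addbb linearN /= twistK subrr; congr (_, _, _).
by rewrite innerNr subrr sub0r Im_innerN oppr0.
Qed.

HB.instance Definition _ := isGroup.Build T
  cg_mulA cg_mul1g cg_mulg1 cg_mulVg cg_mulgV.

(** For untwisted elements the commutator is measured by Im <x, y>, as in the
Heisenberg group. *)
Lemma cg_commute x y (t t' : R) : ⟨x, y⟩ = 0 ->
  commute ((false, x, t) : T) ((false, y, t') : T).
Proof.
move=> xy; have yx : ⟨y, x⟩ = 0 by rewrite innerC xy conjC0.
rewrite /commute.
rewrite -[LHS]/(false, x + twist false y, t + t' - complex.Im ⟨x, twist false y⟩).
rewrite -[RHS]/(false, y + twist false x, t' + t - complex.Im ⟨y, twist false x⟩).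
by rewrite !twist0 xy yx [y + x]addrC [t' + t]addrC.
Qed.

Definition cg_sign (g : T) : bool := g.1.1.
Definition cg_vec (g : T) : H := g.1.2.
Definition cg_psi (g : T) : C :=
  - (⟨cg_vec g, cg_vec g⟩ / 2) + ('i * (g.2)%:C)%C.

Lemma cg_signM (g h : T) : cg_sign (g * h)%g = cg_sign g (+) cg_sign h.
Proof. by move: g h => [[s x] t] [[s' x'] t']. Qed.

Lemma cg_vecM (g h : T) :
  cg_vec (g * h)%g = cg_vec g + twist (cg_sign g) (cg_vec h).
Proof. by move: g h => [[s x] t] [[s' x'] t']. Qed.

Lemma cg_signV (g : T) : cg_sign g^-1%g = cg_sign g.
Proof. by move: g => [[s x] t]. Qed.

Lemma cg_vecV (g : T) : cg_vec g^-1%g = - twist (cg_sign g) (cg_vec g).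
Proof. by move: g => [[s x] t]. Qed.

Lemma cg_psiV (g : T) : cg_psi g^-1%g = (cg_psi g)^*.
Proof.
rewrite /cg_psi cg_vecV; move: g => [[s x] t] /=.
rewrite innerNl innerNr opprK inner_twist twistK.
have : ⟨x, x⟩^* = ⟨x, x⟩ by rewrite -innerC.
have conjD (n z : C) : (- (n / 2) + z)^* = - (n^* / 2) + z^*.
  by rewrite rmorphD rmorphN fmorph_div /= conjC_nat.
rewrite conjD => ->; congr (_ + _); apply/eqP; rewrite eq_complex /=.
by rewrite !(mul0r, mulr0, mul1r, oppr0, add0r, addr0, subr0) !eqxx.
Qed.

Lemma cg_psiM (g h : T) :
  cg_psi (g * h)%g = cg_psi g + cg_psi h + ⟨cg_vec g^-1%g, cg_vec h⟩.
Proof.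
rewrite cg_vecV innerNl inner_twist /cg_psi cg_vecM.
move: g h => [[s x] t] [[s' x'] t'] /=; set y := twist s x'.
have <- : ⟨y, y⟩ = ⟨x', x'⟩ by rewrite inner_twist twistK.
rewrite !innerDl !innerDr [⟨y, x⟩]innerC conj_Im rmorphB rmorphD /=.
by field.
Qed.

End Twist.

(** * The triple of a homomorphism into the Heisenberg-like group *)

Section TwistTriple.
Variables (R : realType) (G : groupType) (rho : G -> cocycle_group R).
Hypothesis rhoM : forall g h, rho (g * h)%g = (rho g * rho h)%g.
Local Notation C := R[i].
Local Notation H := (hplane R).
Local Notation A := (group_algebra C G).
Local Notation eps := (@augmentation C G).

Definition twist_rep (g : G) : {linear H -> H} := twist (cg_sign (rho g)).
Definition twist_eta : {linear A -> H} := gext (fun g => cg_vec (rho g)).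
Definition twist_psi : {scalar A} := gfun (fun g => cg_psi (rho g)).
Definition twist_pi (a : A) : {linear H -> H} := gact twist_rep a.
Definition twist_char (a : A) : C := gfun (fun g => (-1) ^+ cg_sign (rho g)) a.

Lemma twist_rho1 : rho 1%g = 1%g.
Proof. by apply: (mulgI (rho 1%g)); rewrite -rhoM !mulg1. Qed.

Lemma twist_rhoV g : rho g^-1%g = (rho g)^-1%g.
Proof. by apply: (mulgI (rho g)); rewrite -rhoM !mulgV twist_rho1. Qed.

Lemma twist_triple : schuermann_triple eps twist_pi twist_eta twist_psi.
Proof.
apply: group_triple => [v|g h v|g u v|g h|g|g h].
- by rewrite /= twist_rho1 twist0.
- by rewrite /= rhoM cg_signM twistM.
- by rewrite /= twist_rhoV cg_signV inner_twist.
- by rewrite rhoM cg_vecM addrC.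
- by rewrite twist_rhoV cg_psiV.
- by rewrite rhoM cg_psiM twist_rhoV.
Qed.

Lemma twist_piE a v : twist_pi a v = (augmentation a * v.1, twist_char a * v.2).
Proof.
elim/galg_lin_ind: a => [g||c a IH|a b IHa IHb].
- by rewrite /twist_pi /= gactE augmentation_gelt mul1r /twist_char gfunE.
- by rewrite /twist_pi /= gact0l /twist_char !linear0 !mul0r.
- rewrite /twist_pi /= gactZl -[gact _ a v]/(twist_pi a v) IH /twist_char !linearZ /=.
  by congr (_, _); rewrite -mulrA.
- rewrite /twist_pi /= gactDl -[gact _ a v]/(twist_pi a v) IHa.
  rewrite -[gact _ b v]/(twist_pi b v) IHb /twist_char.
  by rewrite !linearD /= !mulrDl.
Qed.

Definition fst_axis (x : H) : H := (x.1, 0).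
Definition snd_axis (x : H) : H := (0, x.2).

Lemma fst_axis_linear : linear fst_axis.
Proof. by move=> c x y; congr (_, _); rewrite /= scaler0 addr0. Qed.
HB.instance Definition _ := GRing.isLinear.Build C H H _ fst_axis fst_axis_linear.

Lemma snd_axis_linear : linear snd_axis.
Proof. by move=> c x y; congr (_, _); rewrite /= scaler0 addr0. Qed.
HB.instance Definition _ := GRing.isLinear.Build C H H _ snd_axis snd_axis_linear.

Hypothesis signed : exists g, cg_sign (rho g).

(** The operators pi a - eps a annihilate the first coordinate, and at a group
element with sign -1 such an operator is -2 on the second coordinate. *)
Lemma twist_remainder x : remainder_space eps twist_pi (idfun : H -> H) x <-> x.1 = 0.
Proof.
split=> [xr|x1].
  (* Otherwise the ball about x of radius |x.1| misses the second axis, which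
     contains the span. *)
  have [/eqP //|x0] := boolP (x.1 == 0).
  have e0 : 0 < `|x.1 : C| by rewrite normr_gt0.
  have [y [[n [c [s [sP ->]]]] xy]] := xr _ (nbhsx_ballx x _ e0).
  have y1 : (\sum_(i < n) c i *: s i).1 = 0.
    apply: (big_ind (fun y : H => y.1 = 0)) => //= [u v /= -> ->|i _].
      exact: addr0.
    have [a _ [v _ <-]] := sP i; rewrite twist_piE /=.
    by rewrite -[eps a *: v.1]/(eps a * v.1) subrr scaler0.
  move: xy; rewrite -ball_normE /ball_ /= => /(le_lt_trans (coord1_le _)).
  by rewrite /= y1 subr0 ltxx.
apply: subset_closure; have [g gs] := signed.
exists 1%N, (fun=> 1), (fun=> x); split; last by rewrite big_ord1 scale1r.
move=> _; exists (gelt C g) => //; exists (- (x.2 / 2) *: (0, 1) : H) => //.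
rewrite twist_piE /= augmentation_gelt /twist_char gfunE gs.
case: x x1 => u v /= ->; congr (_, _).
  by rewrite /= scaler0 mulr0 scale1r subrr.
rewrite /= expr1 scale1r -[_ *: 1]/(_ * 1) mulr1; by field.
Qed.

Lemma snd_axis_projection :
  orthogonal_projection (remainder_space eps twist_pi (idfun : H -> H)) snd_axis.
Proof.
move=> x; split; first by apply/twist_remainder.
move=> y /twist_remainder y1.
by rewrite innerE /= y1 conjC0 mul0r subrr mulr0 addr0.
Qed.

Lemma fst_axis_projection :
  orthogonal_projection (gaussian_space eps twist_pi (idfun : H -> H)) fst_axis.
Proof.
move=> x; split=> [y /twist_remainder y1|y yG].
  by rewrite innerE /= y1 conjC0 mul0r mulr0 addr0.
rewrite innerC (_ : x - fst_axis x = snd_axis x) ?yG ?conjC0 //.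
  by apply/twist_remainder.
by case: x => u v; congr (_, _); rewrite /= ?subrr ?subr0.
Qed.

Hypothesis eta_surj : forall v, exists a, twist_eta a = v.

Definition twist_emb : {linear H -> H} := idfun.
Local Notation DG := (linear_image (fst_axis \o twist_emb)).
Local Notation DR := (linear_image (snd_axis \o twist_emb)).

Lemma twist_completion : completion twist_emb.
Proof.
by split=> // O [x Ox] _; exists x; split=> //; exists x.
Qed.

Definition twist_piG (a : A) : {linear DG -> DG} := *:%R (augmentation a).
Definition twist_piR (a : A) : {linear DR -> DR} := *:%R (twist_char a).

Definition twist_LK_data : LK_data eps twist_psi.
Proof.
refine (@Build_LK_data C A eps twist_psi H twist_pi twist_eta twist_triple
  eta_surj H twist_emb twist_completion fst_axis fst_axis_projection
  snd_axis snd_axis_projection twist_piG _ twist_piR _).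
  by [].
move=> a b; rewrite /= twist_piE; congr (_, _); last by rewrite /= subrK.
by rewrite /= !scaler0 subrr addr0.
Defined.

Lemma twist_inner_etaG g h :
  ⟨lk_etaG twist_LK_data (gelt C g), lk_etaG twist_LK_data (gelt C h)⟩ =
  (cg_vec (rho g)).1^* * (cg_vec (rho h)).1.
Proof.
rewrite -[LHS]/⟨fst_axis (twist_eta (gelt C g)), fst_axis (twist_eta (gelt C h))⟩.
by rewrite innerE /= mulr0 addr0 !gextE.
Qed.

End TwistTriple.

(** * The example *)

Section SurfaceExample.
Variables (R : realType) (k : nat).
Hypothesis k_ge2 : (2 <= k)%N.
Local Notation C := R[i].
Local Notation H := (hplane R).
Local Notation T := (cocycle_group R).

(** The first handle carries orthogonal vectors whose first coordinates 1 and i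
have a nonzero obstruction; a_2 supplies the sign. *)
Definition surface_image (x : 'I_k + 'I_k) : T :=
  match x with
  | inl i => if i == 0%N :> nat then (false, (1, 1) : H, 0) : T
             else if i == 1%N :> nat then (true, 0, 0) : T else 1%g
  | inr i => if i == 0%N :> nat then (false, ('i%C, - 'i%C) : H, 0) : T else 1%g
  end.

Lemma surface_image_comm i :
  commute (surface_image (inl i)) (surface_image (inr i)).
Proof.
rewrite /surface_image; case: eqP => [_|_]; last by rewrite /commute mulg1 mul1g.
by apply: cg_commute; rewrite innerE /= conjC1 !mul1r addrC addNr.
Qed.

Lemma surface_image_relator r :
  [set surface_relator k] r -> word_eval surface_image r = 1%g.
Proof.
move=> ->; rewrite /surface_relator; elim: (enum _) => //= i s ->.
by rewrite !mulg1 !mulgA surface_image_comm mulgK mulgV.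
Qed.

Definition surface_rho : surface_group k -> T := pres_lift surface_image.

Lemma surface_rhoM g h :
  surface_rho (g * h)%g = (surface_rho g * surface_rho h)%g.
Proof. exact: (pres_liftM surface_image_relator). Qed.

Lemma surface_rho_gen x : surface_rho (surface_gen x) = surface_image x.
Proof. exact: (pres_lift_gen surface_image_relator). Qed.

Definition ord_0 : 'I_k := Ordinal (ltnW k_ge2).
Definition ord_1 : 'I_k := Ordinal k_ge2.

Lemma surface_rho_signed : exists g, cg_sign (surface_rho g).
Proof. by exists (surface_gen (inl ord_1)); rewrite surface_rho_gen. Qed.

Lemma surface_etaE x :
  twist_eta surface_rho (gelt C (surface_gen x)) = cg_vec (surface_image x).
Proof. by rewrite [LHS]gextE surface_rho_gen. Qed.

Lemma surface_eta_surj v : exists a, twist_eta surface_rho a = v.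
Proof.
pose A := group_algebra C (surface_group k).
have etaP (c d : C) (x y : A) : twist_eta surface_rho (c *: x + d *: y) =
    c *: twist_eta surface_rho x + d *: twist_eta surface_rho y.
  exact: gext_comb.
(* Solve c (1, 1) + d (i, -i) = v for c and d. *)
exists (((v.1 + v.2) / 2) *: (gelt C (surface_gen (inl ord_0)) : A)
  + ((v.1 - v.2) / (2 * 'i%C)) *: (gelt C (surface_gen (inr ord_0)) : A)).
have i0 : 'i%C != 0 :> C by rewrite eq_complex /= oner_eq0 andbF.
rewrite etaP !surface_etaE /=; case: v => u w; congr (_, _).
  rewrite /= -[(_ / 2) *: _]/(_ * _) -[(_ / (2 * _)) *: _]/(_ * _).
  by field; rewrite i0.
rewrite /= -[(_ / 2) *: _]/(_ * _) -[(_ / (2 * _)) *: _]/(_ * _).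
by field; rewrite i0.
Qed.

End SurfaceExample.

Theorem proposition4p3 (R : realType) (k : nat) (hk : (2 <= k)%N) :
  ~ has_LK (@augmentation R[i]%C (surface_group k)).
Proof.
pose rhoM := @surface_rhoM R k.
have triple := twist_triple rhoM.
have psi_gen := triple_generating (@augmentation_star _ _) triple.
move=> has_decomposition.
have [psiG [psiR [_ _ _ tripleG _]]] :=
  has_decomposition _ psi_gen (twist_LK_data rhoM (surface_rho_signed R hk)
  (surface_eta_surj hk)).
have := gaussian_surface_obstruction tripleG (fun a b => erefl).
under eq_bigr => i _ do rewrite !twist_inner_etaG !surface_rho_gen.
rewrite (bigD1 (ord_0 hk)) //= big1 => [|i].
  (* The first handle contributes -2i. *)
  rewrite conjC1 mulr1 mul1r addr0 => /(congr1 (@complex.Im R)) /= im0.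
  by lra.
rewrite -val_eqE /= => /negbTE -> /=.
by case: ifP => _ /=; rewrite conjC0 !mul0r subrr.
Qed.
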